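(* Let $g_{n}$ ($n\ge 0$, $n\equiv 0$ or $2\bmod 6$) be a $\mathbb{Z}/2$-basis of $\ker\varphi$ with $g_{n}$ of degree $n$, chosen so that for all $m\ge 0$: $g_{12m}=(t^{6}+t^{5})^{2m}+O(t^{12m-2})$; $g_{12m+6}=(t^{6}+t^{5})^{2m}(t^{6}+t^{5}+t^{4}+t^{3}+t^{2}+t)+O(t^{12m})$; $g_{12m+2}=(t^{6}+t^{5})^{2m}(t^{2}+t)+O(t^{12m})$; $g_{12m+8}=(t^{6}+t^{5})^{2m}t^{8}+O(t^{12m+4})$. Let $f_{n}=(r^{2}+r)g_{n}(r^{2})$; the $f_{n}$ are a $\mathbb{Z}/2$-basis of $K$. Consider the composite map $K\subset N2\rightarrow N2/N1=N2a\oplus N2b\rightarrow N2a$. Then for all $m\ge 0$: (a) $f_{12m}$ maps to $J_{20m+1}+O^{*}(J_{20m-11})$. (b) $f_{12m+6}$ maps to $J_{20m+3}+O^{*}(J_{20m+1})$. (c) $f_{12m+2}$ maps to $J_{20m+7}+O^{*}(J_{20m+3})$. (d) $f_{12m+8}$ maps to $J_{20m+9}+O^{*}(J_{20m+7})$. Furthermore: (e) The map $K\subset N2\rightarrow N2a$ is bijective.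
   Context: Work in the polynomial ring $\mathbb{Z}/2[r]$. Let $F=r(r+1)^{5}$ and $G=r^{5}(r+1)$. Since $1,r,r^2,r^3,r^4,r^5$ is a basis of $\mathbb{Z}/2[r]$ over $\mathbb{Z}/2[G]$, there is a unique $\mathbb{Z}/2$-linear map $U:\mathbb{Z}/2[r]\to\mathbb{Z}/2[r]$ satisfying $U(Gf)=F\,U(f)$ for all $f$ and taking $1,r,r^{2},r^{3},r^{4},r^{5}$ to $1,\ r,\ r^{2},\ r^{3}+r^{2}+r,\ r^{4},\ r^{5}+r^{4}+r$ respectively. $I$ is the identity map. $M(\mathit{odd})\subset\mathbb{Z}/2[r]$ is the space of all $(r^{2}+r)g(r^{2})$ with $g\in\mathbb{Z}/2[t]$; $U$ stabilizes it, and $K$ is the kernel of $U+I:M(\mathit{odd})\to M(\mathit{odd})$. The polynomials $C_{n}\in \mathbb{Z}/2[t]$, $n\ge 0$, are defined by $C_{n+6}=C_{n+5}+(t^{6}+t^{5}+t^{2}+t)C_{n}+t^{n}(t^{2}+t)$, with $C_{0}=0$, $C_{1}=C_{2}=1$, $C_{3}=t$, $C_{4}=t^{2}$, $C_{5}=t^{4}+t^{2}+t$. The map $\varphi:\mathbb{Z}/2[t]\to\mathbb{Z}/2[t]$ is the $\mathbb{Z}/2$-linear map taking $t^{k}$ to $C_{k}$ for all $k\ge 0$. For an integer $m$, $O(t^{m})$ denotes an unspecified element of $\mathbb{Z}/2[t]$ of degree $\le m$ (so $0$ if $m<0$). $N2$ is the $\mathbb{Z}/2[G^{2}]$-submodule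 of $M(\mathit{odd})$ generated by $u_{0}=F+G$, $u_{1}=(F+G)^{3}+G$, $u_{2}=G$, $u_{4}=(F+G)^{2}G$, $u_{5}=(F+G)^{4}G+(F+G)FG$; equivalently it is free over $\mathbb{Z}/2[G^2]$ on $G,F,F^{2}G,F^{3},F^{4}G$. It is a fact that $K\subset N2$. $N1$ is the $\mathbb{Z}/2[G^{2}]$-submodule of $N2$ generated by $G$. $J_{1}=F$, $J_{7}=F^{2}G$, $J_{9}=F^{4}G$, $J_{3}=F^{8}/G$ (all in $N2$), and $J_{k}$ is defined for all $k>0$ prime to $10$ by $J_{k+10}=G^{2}J_{k}$. The same symbol $J_k$ denotes the image in $N2/N1$; the $J_{k}$ ($k>0$, $(k,10)=1$) form a $\mathbb{Z}/2$-basis of $N2/N1$. $N2a$ is the subspace of $N2/N1$ spanned by the $J_{k}$ with $k\equiv 1,3,7,9\bmod 20$, and $N2b$ is the subspace spanned by the $J_{k}$ with $k\equiv 11,13,17,19\bmod 20$; thus $N2/N1=N2a\oplus N2b$. $O^{*}(J_{k})$ denotes an unspecified element of $N2/N1$ that is a sum of $J_{i}$ with $i\le k$ (so $0$ if $k\le 0$). *)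

(* Defs.v *)
From HB Require Import structures.
From mathcomp Require Import all_boot all_order all_algebra.
From mathcomp Require Import boolp classical_sets functions.

Set Implicit Arguments.
Unset Strict Implicit.
Unset Printing Implicit Defensive.

Import GRing.Theory.

Local Open Scope classical_set_scope.
Local Open Scope ring_scope.
Local Open Scope quotient_scope.

(* A single type of polynomials serves for both Z/2[r] and Z/2[t]. *)
Notation PF2 := {poly 'F_2}.

Definition F : PF2 := 'X * ('X + 1) ^+ 5.
Definition G : PF2 := 'X ^+ 5 * ('X + 1).

Lemma size_G : size G = 7.
Proof.
by rewrite /G size_Mmonic ?polyX_neq0 ?expf_neq0 ?polyX_eq0 // ?size_polyXn
  ?(size_XaddC 1) // monicE (lead_coefXaddC 1).
Qed.

Lemma G_neq0 : G != 0.
Proof. by rewrite -size_poly_eq0 size_G. Qed.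

Definition is_U (U : PF2 -> PF2) : Prop :=
  (forall f, U (G * f) = F * U f) /\
  [/\ U 1 = 1, U 'X = 'X & U 'X^2 = 'X^2] /\
  [/\ U 'X^3 = 'X^3 + 'X^2 + 'X, U 'X^4 = 'X^4
    & U 'X^5 = 'X^5 + 'X^4 + 'X].

(* For g in Z/2[t], this is (r^2 + r) g(r^2). *)
Definition to_Modd (g : PF2) : PF2 := ('X^2 + 'X) * (g \Po 'X^2).

Definition Modd : set PF2 := range to_Modd.

Definition K (U : PF2 -> PF2) : set PF2 := [set f | Modd f /\ U f + f = 0].

Fixpoint C (n : nat) : PF2 :=
  match n with
  | 0 => 0
  | 1 => 1
  | 2 => 1
  | 3 => 'X
  | 4 => 'X^2
  | 5 => 'X^4 + 'X^2 + 'X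
  | ((k.+4).+1 as k5).+1 =>
      C k5 + ('X^6 + 'X^5 + 'X^2 + 'X) * C k + 'X^k * ('X^2 + 'X)
  end.

Definition phi (p : PF2) : PF2 := \sum_(k < size p) p`_k *: C k.

Definition ker_phi : set PF2 := [set p | phi p = 0].

(* p = O(t^d); the zero polynomial is the only O(t^d) when d < 0. *)
Definition Odeg (d : int) (p : PF2) : Prop :=
  p != 0 -> ((size p).-1%:Z <= d)%R.

(* (e n), for n ranging over the indices satisfying P, is a basis of the
   subspace S. *)
Definition is_basis (V : lmodType 'F_2) (P : pred nat) (e : nat -> V)
    (S : set V) : Prop :=
  [/\ forall n, P n -> S (e n),
      forall (N : nat) (c : nat -> 'F_2),
        \sum_(n < N | P n) c n *: e n = 0 ->
        forall n, (n < N)%N -> P n -> c n = 0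
    & forall x, S x -> exists (N : nat) (c : nat -> 'F_2),
        x = \sum_(n < N | P n) c n *: e n].

Definition gidx (n : nat) : bool := (n %% 6 == 0)%N || (n %% 6 == 2)%N.

(* The Z/2[G^2]-submodule of Z/2[r] generated by the elements of s; the
   coefficient in Z/2[G^2] of the i-th generator is (a i)(G^2). *)
Definition gen (s : seq PF2) : set PF2 :=
  [set f | exists a : nat -> PF2,
     f = \sum_(i < size s) (a i \Po (G ^+ 2)) * s`_i].

Definition u0 : PF2 := F + G.
Definition u1 : PF2 := (F + G) ^+ 3 + G.
Definition u2 : PF2 := G.
Definition u4 : PF2 := (F + G) ^+ 2 * G.
Definition u5 : PF2 := (F + G) ^+ 4 * G + (F + G) * F * G.

Definition N2 : set PF2 := gen [:: u0; u1; u2; u4; u5].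

Definition N1 : pred PF2 := fun f => `[< gen [:: G] f >].

Lemma N1_zmod_closed : zmod_closed N1.
Proof.
split=> [|x y].
  by apply/asboolP; exists (fun=> 0); rewrite big_ord1 comp_poly0 mul0r.
move=> /asboolP[a ->] /asboolP[b ->]; apply/asboolP.
exists (fun i => a i - b i).
by rewrite !big_ord1 comp_polyB mulrBl.
Qed.

HB.instance Definition _ := GRing.isZmodClosed.Build PF2 N1 N1_zmod_closed.

Definition N1_zmod : zmodClosed PF2 := GRing.ZmodClosed.clone PF2 N1 _.

(* The quotient group Z/2[r] / N1, in which N2 / N1 is the image of N2. *)
Definition quotN1 := Quotient.quot N1_zmod.
HB.instance Definition _ := GRing.Zmodule.on quotN1.

Definition modN1 (f : PF2) : quotN1 := \pi_(Quotient.quot N1_zmod) f.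

(* G divides F ^+ 8 (see F8_divG), so J 3 is F^8/G. The value is 0 at the
   indices not prime to 10. *)
Fixpoint J (k : nat) : PF2 :=
  match k with
  | 1 => F
  | 3 => F ^+ 8 %/ G
  | 7 => F ^+ 2 * G
  | 9 => F ^+ 4 * G
  | (((j.+4).+4).+1).+1 => G ^+ 2 * J j
  | _ => 0
  end.

Lemma F8_divG : (F ^+ 8 %/ G) * G = F ^+ 8.
Proof.
have -> : F ^+ 8 = 'X ^+ 3 * ('X + 1) ^+ 39 * G.
  rewrite /F /G; move: ('X + 1) => y; rewrite exprMn -exprM.
  by rewrite [RHS]mulrACA -exprD -exprSr.
by rewrite mulpK // G_neq0.
Qed.

Definition Jidx (k : nat) : bool := (0 < k)%N && coprime k 10.

(* Over Z/2, the span of a family is the set of its finite sums. *)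
Definition spanJ (P : pred nat) : set quotN1 :=
  [set x | exists s : seq nat,
     all (fun k => Jidx k && P k) s /\ x = \sum_(k <- s) modN1 (J k)].

Definition N2a : set quotN1 :=
  spanJ (fun k => (k %% 20 \in [:: 1; 3; 7; 9])%N).
Definition N2b : set quotN1 :=
  spanJ (fun k => (k %% 20 \in [:: 11; 13; 17; 19])%N).

(* x = O^*(J_d) *)
Definition Ostar (d : int) : set quotN1 := spanJ (fun k => (k%:Z <= d)%R).

(* The projection of N2 / N1 = N2a (+) N2b on N2a; the junk value outside of
   N2 / N1 is 0. *)
Definition proj_N2a (x : quotN1) : quotN1 :=
  xget 0 [set y | N2a y /\ N2b (x - y)].

Definition to_N2a (f : PF2) : quotN1 := proj_N2a (modN1 f).

(* There is exactly one linear map satisfying is_U. *)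

(* U computed from the G-adic expansion of its argument. *)
Definition U_digit (p : PF2) : PF2 :=
  \sum_(i < 6) p`_i *: nth 0
    [:: 1; 'X; 'X^2; 'X^3 + 'X^2 + 'X; 'X^4; 'X^5 + 'X^4 + 'X] i.

Definition U_trunc (N : nat) (f : PF2) : PF2 :=
  \sum_(i < N) F ^+ i * U_digit ((f %/ G ^+ i) %% G).

Lemma size_Gn n : size (G ^+ n) = (6 * n).+1.
Proof.
have := size_exp G n; rewrite size_G /= => <-.
by rewrite prednK // lt0n size_poly_eq0 expf_neq0 // G_neq0.
Qed.

Lemma U_truncE N (f : PF2) : (size f <= N)%N -> U_trunc N f = U_trunc (size f) f.
Proof.
move=> leN; rewrite /U_trunc -(subnKC leN) big_split_ord /= [X in _ + X]big1.
  by rewrite addr0.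
move=> i _; rewrite divp_small.
  rewrite mod0p /U_digit big1 ?mulr0 // => j _.
  by rewrite coef0 scale0r.
rewrite size_Gn ltnS; apply: leq_trans (leq_addr i _) _.
by rewrite leq_pmull.
Qed.

Lemma U_digit_linear (a : 'F_2) (p q : PF2) :
  U_digit (a *: p + q) = a *: U_digit p + U_digit q.
Proof.
rewrite /U_digit scaler_sumr -big_split /=; apply: eq_bigr => i _.
by rewrite coefD coefZ scalerDl scalerA.
Qed.

Lemma U_trunc_linear N (a : 'F_2) (p q : PF2) :
  U_trunc N (a *: p + q) = a *: U_trunc N p + U_trunc N q.
Proof.
rewrite /U_trunc scaler_sumr -big_split /=; apply: eq_bigr => i _.
by rewrite divpD divpZl modpD modpZl U_digit_linear mulrDr scalerAr.
Qed.

Definition U_fun (f : PF2) : PF2 := U_trunc (size f) f.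

Lemma U_fun_linear : linear U_fun.
Proof.
move=> a p q; rewrite /U_fun.
set N := (size (a *: p + q)%R + (size p + size q))%N.
rewrite -(@U_truncE N (a *: p + q)) ?leq_addr //.
rewrite -(@U_truncE N p); last by rewrite /N addnCA leq_addr.
rewrite -(@U_truncE N q); last by rewrite /N addnA leq_addl.
exact: U_trunc_linear.
Qed.

HB.instance Definition _ :=
  GRing.isLinear.Build 'F_2 PF2 PF2 _ U_fun U_fun_linear.

Lemma U_fun_small (p : PF2) : (size p <= 6)%N -> U_fun p = U_digit p.
Proof.
move=> lep; rewrite /U_fun -(@U_truncE (size p).+1) // /U_trunc.
rewrite big_ord_recl expr0 mul1r divp1 modp_small ?size_G //.
rewrite big1 ?addr0 // => i _ /=; rewrite divp_small.
  rewrite mod0p /U_digit big1 ?mulr0 // => j _.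
  by rewrite coef0 scale0r.
rewrite size_Gn /bump /= add1n ltnS; apply: leq_trans lep _.
by rewrite leq_pmulr.
Qed.

Lemma U_fun_is_U : is_U U_fun.
Proof.
split=> [f|].
  rewrite /U_fun -(@U_truncE (size (G * f)%R + size f).+1); last first.
    by rewrite leqW // leq_addr.
  rewrite /U_trunc big_ord_recl expr0 mul1r divp1 modp_mulr.
  have -> : U_digit 0 = 0.
    by rewrite /U_digit big1 // => j _; rewrite coef0 scale0r.
  rewrite add0r -/(U_trunc (size f) f).
  rewrite -(@U_truncE (size (G * f)%R + size f)) ?leq_addl //.
  rewrite /U_trunc mulr_sumr; apply: eq_bigr => i _ /=.
  rewrite /bump /= add1n !exprS mulrA -divp_divl mulKp ?G_neq0 //.
by rewrite !U_fun_small ?size_poly1 ?size_polyX ?size_polyXn //;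
  rewrite /U_digit !big_ord_recl !big_ord0 /= !coefE /=
    !(scale0r, scale1r, add0r, addr0).
Qed.

Lemma is_U_unique (U V : {linear PF2 -> PF2}) : is_U U -> is_U V -> U =1 V.
Proof.
move=> [UG [[U0 U1 U2] [U3 U4 U5]]] [VG [[V0 V1 V2] [V3 V4 V5]]].
have small (p : PF2) : (size p <= 6)%N -> U p = V p.
  move=> lep; rewrite -[p]coefK poly_def !raddf_sum /=.
  apply: eq_bigr => -[i lti] _ /=; rewrite !linearZ /=; congr (_ *: _).
  have: (i < 6)%N by apply: leq_trans lti lep.
  move: i {lti} => [|[|[|[|[|[|//]]]]]] _;
    by rewrite ?expr0 ?expr1 ?(U0, U1, U2, U3, U4, U5, V0, V1, V2, V3, V4, V5).
move=> f; have [n] := ubnP (size f); elim: n f => // n IH f.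
rewrite ltnS => lef; have [/small//|ltf] := leqP (size f) 6.
rewrite (divp_eq f G) !linearD /= mulrC UG VG IH.
  congr (_ + _); apply: small.
  by rewrite -ltnS -[7%N in X in (_ <= X)%N]size_G ltn_modp G_neq0.
rewrite size_divp ?G_neq0 // size_G; apply: leq_trans lef.
by rewrite ltn_subrL (leq_trans _ ltf).
Qed.

(* Main.v *)
Require Import Defs.
From HB Require Import structures.
From mathcomp Require Import all_boot all_order all_algebra ring zify.
From mathcomp Require Import boolp classical_sets functions.
Import GRing.Theory.
Local Open Scope classical_set_scope.
Local Open Scope ring_scope.

Set Implicit Arguments.
Unset Strict Implicit.
Unset Printing Implicit Defensive.

(** Put [s = r^2 + r]. The substitution [W : r |-> r + 1] exchanges [F] and
    [G], and [F + G = s], [F G = s^6].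

    The space [K]. Writing [A_k = (r^2 + r) r^(2k)], the rule
    [U (G^2 x) = F^2 (U x)] turns [A_(k+6) = A_(k+5) + G^2 A_k] into the
    recursion that defines the [C_k], so that [(U + I) A_k] is the element of
    M(odd) attached to [C_k] ([U_to_Modd_Xn]). Hence [g |-> (r^2 + r) g(r^2)]
    carries the kernel of [phi] isomorphically onto [K] ([K_basis]).

    Why [K] lies in [N2]. The operator [L = U + W] satisfies [L (G x) = F (L x)]
    and takes [1, r, ..., r^5] to [0, 1, 1, 1, 1, 1]; it is the trace of Z/2[r]
    over Z/2[G] followed by [G |-> F]. In particular [L f] is a polynomial in
    [F]. If [U f = f], then [L f = f + W f] is invariant under [W], hence it is
    at the same time [q(F)] and [q(G)]; comparing orders at [r = 0] gives
    [q = 0] ([comp_FG_eq0], [L_K_eq0]). Now M(odd) is generated over Z/2[G^2] by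
    the five generators of [N2], on which [L] vanishes, together with one more
    element, on which [L] takes the value [F]. So an element of M(odd) killed by
    [L] lies in [N2] ([K_sub_N2]).

    The [J_k]. The lowest power of [r] in [J_k] is [r^k], with [k] prime to 10,
    while nonzero elements of [N1] start in a degree congruent to 5 modulo 10.
    So the [J_k] are independent modulo [N1] ([J_free]), and the projection to
    [N2a] makes sense.

    The leading terms. The elements [G^(2i) u_j] have pairwise distinct degrees
    [12 i + 2, 4, 6, 10, 12] in [r], so an element of [N2] of degree at most [d]
    is a sum of those of degree at most [d]. Modulo [N1] the [u_j] are [J_1],
    [J_3 + J_7], [0], [J_7] and [J_7 + J_9 + J_11], which converts a bound on
    the degree into a bound on the indices of the [J_k] ([N2_spanJ]). The assumed
    shape of [g_n] gives the top part of [f_n] and the rest is bounded in this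
    way ([to_Modd_approx]).

    Finally, ordered by leading index, the images of the [f_n] are unitriangular
    with respect to the basis of [N2a] made of the [J_k], and each [k] occurs as
    leading index exactly once; this makes the map bijective ([to_N2a_bij]). *)

(** * Characteristic two *)

Lemma even_F2 n : (2 * n)%:R = 0 :> {poly 'F_2}.
Proof. by rewrite natrM -polyC_natr pchar_Zp ?polyC0 ?mul0r. Qed.

Lemma odd_F2 n : (2 * n + 1)%:R = 1 :> {poly 'F_2}.
Proof. by rewrite natrD even_F2 add0r. Qed.

(** The ring tactic works over the integers; the extra equations reduce its
    integer coefficients modulo 2. A hint rewrites only the coefficient equal to
    its left-hand side, hence one hint for each integer that occurs. *)
Ltac ring2 := ring: (even_F2 1) (odd_F2 1) (even_F2 2) (odd_F2 2) (even_F2 3)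
  (odd_F2 3) (even_F2 4) (odd_F2 4) (even_F2 5) (odd_F2 5) (even_F2 6)
  (odd_F2 6) (even_F2 7) (odd_F2 7) (even_F2 8) (odd_F2 8) (even_F2 9)
  (odd_F2 9) (even_F2 10) (odd_F2 10) (even_F2 11) (odd_F2 11) (even_F2 12).

Lemma addpp (p : {poly 'F_2}) : p + p = 0.
Proof. ring2. Qed.

Lemma opprF2 (p : {poly 'F_2}) : - p = p.
Proof. by apply/eqP; rewrite eq_sym -addr_eq0 addpp. Qed.

Lemma subrF2 (p q : {poly 'F_2}) : p - q = p + q.
Proof. by rewrite opprF2. Qed.

Lemma F2_neq0 (c : 'F_2) : c != 0 -> c = 1.
Proof. by case: c => -[|[|//]] // lt2 _; apply: val_inj. Qed.

(** * The substitution r -> r + 1 and the elements of M(odd) *)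

Local Notation s := ('X^2 + 'X : {poly 'F_2}).

Lemma FE : F = 'X^6 + 'X^5 + 'X^2 + 'X.
Proof. rewrite /F; ring2. Qed.

Lemma size_GE : size G = 7%N. Proof. exact: size_G. Qed.

Lemma addFG : F + G = s.
Proof. rewrite /F /G; ring2. Qed.

Lemma mulFG : F * G = s ^+ 6.
Proof. rewrite /F /G; ring2. Qed.

Definition W : {poly 'F_2} -> {poly 'F_2} := comp_poly ('X + 1).
HB.instance Definition _ := GRing.Linear.on W.
HB.instance Definition _ := GRing.RMorphism.on W.

Lemma WX : W 'X = 'X + 1.
Proof. exact: comp_polyX. Qed.

Lemma WK : involutive W.
Proof.
move=> p; rewrite /W -comp_polyA comp_polyD comp_polyX comp_polyC -addrA addpp.
by rewrite addr0 comp_polyXr.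
Qed.

Lemma WF : W F = G.
Proof.
rewrite /F /G !(rmorphM, rmorphXn, rmorphD) /= WX rmorph1 -addrA addpp.
ring2.
Qed.

Lemma WG : W G = F.
Proof.
rewrite /F /G !(rmorphM, rmorphXn, rmorphD) /= WX rmorph1 -addrA addpp.
ring2.
Qed.

Lemma to_Modd_linear : linear to_Modd.
Proof. by move=> a p q; rewrite /to_Modd linearP mulrDr scalerAr. Qed.
HB.instance Definition _ :=
  GRing.isLinear.Build 'F_2 {poly 'F_2} {poly 'F_2} _ to_Modd to_Modd_linear.

Lemma s_neq0 : s != 0.
Proof.
by rewrite -size_poly_eq0 size_polyDl ?size_polyXn ?size_polyX.
Qed.

Lemma size_s : size s = 3.
Proof. by rewrite size_polyDl ?size_polyXn ?size_polyX. Qed.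

Lemma size_comp_Xn (p : {poly 'F_2}) n :
  (size (p \Po 'X^(n.+1))).-1 = ((size p).-1 * n.+1)%N.
Proof. by rewrite size_comp_poly size_polyXn. Qed.

Lemma size_to_Modd g : g != 0 -> size (to_Modd g) = (2 * size g + 1)%N.
Proof.
move=> g0; have g20 : g \Po 'X^2 != 0.
  by rewrite comp_poly_eq0 // size_polyXn.
rewrite /to_Modd size_mul ?s_neq0 // size_s -(@prednK (size (g \Po _))) ?lt0n
  ?size_poly_eq0 //.
rewrite size_comp_Xn; move: g0; rewrite -size_poly_gt0; lia.
Qed.

Lemma to_Modd_inj : injective to_Modd.
Proof.
apply: raddf_inj => g /eqP; apply: contraTeq => /size_to_Modd sg.
by rewrite -size_poly_eq0 sg addn1.
Qed.

Lemma to_ModdD : {morph to_Modd : p q / p + q}.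
Proof. exact: raddfD. Qed.

(** [to_Modd] is semilinear along [t |-> r^2], under which [t^6 + t^5] becomes
    [G^2]. *)
Lemma to_ModdM p q : to_Modd (p * q) = (p \Po 'X^2) * to_Modd q.
Proof. by rewrite /to_Modd rmorphM mulrCA. Qed.

Lemma to_Modd_XMl g : to_Modd (('X^6 + 'X^5) * g) = G ^+ 2 * to_Modd g.
Proof.
rewrite to_ModdM raddfD /= !comp_Xn_poly; congr (_ * _); rewrite /G; ring2.
Qed.

(** The trace of Z/2[r] over Z/2[G], followed by the substitution [G |-> F]. *)
Definition UW (U : {linear {poly 'F_2} -> {poly 'F_2}}) f := U f + W f.
Lemma UW_linear U : linear (UW U).
Proof. by move=> a p q; rewrite /UW !linearP addrACA scalerDr. Qed.
HB.instance Definition _ U :=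
  GRing.isLinear.Build 'F_2 {poly 'F_2} {poly 'F_2} _ (UW U) (UW_linear U).

(** * K is the image of the kernel of phi *)

Section Operator.
Variables (U : {linear {poly 'F_2} -> {poly 'F_2}}) (Uis : is_U U).

Lemma U_G f : U (G * f) = F * U f. Proof. by case: Uis => ->. Qed.

(** Both sides satisfy the same recursion: the sequence [to_Modd 'X^k] has
    characteristic polynomial [x^6 + x^5 + G^2], [U] turns [G^2] into
    [F^2 = t^6 + t^5 + t^2 + t] with [t = r^2], and the discrepancy
    [F^2 + G^2 = s^2] accounts for the inhomogeneous term
    [t^k (t^2 + t)] of the recursion of [C]. *)
Lemma U_to_Modd_Xn k :
  U (to_Modd 'X^k) + to_Modd 'X^k = to_Modd (C k).
Proof.
have [_ [[U0 U1 U2] [U3 U4 U5]]] := Uis.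
have e k' : to_Modd 'X^k' = 'X^((2 * k').+2) + 'X^((2 * k').+1).
  by rewrite /to_Modd comp_Xn_poly -exprM mulrDl -exprD -exprS.
have UX n : U ('X^(n.+2.+4) + 'X^(n.+1.+4)) = F * U 'X^n.
  rewrite -U_G; congr (U _); rewrite /G !exprS; ring.
have U6 : U 'X^6 = 'X^5 + 'X^4 + 'X + F.
  have := UX 0%N; rewrite expr0 U0 mulr1 linearD /= U5 => <-; ring2.
have [n] := ubnP k.
elim: n k => // n IH [|[|[|[|[|[|k]]]]]]; rewrite ltnS => ltn.
- by rewrite e linearD /= expr1 U1 U2 addpp /= raddf0.
- rewrite e linearD /= U3 U4 /to_Modd /= rmorph1; ring2.
- rewrite [in U _]e UX e /= expr0 U0 /to_Modd rmorph1 /F; ring2.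
- rewrite [in U _]e UX e /= U2 /to_Modd /= comp_polyX /F; ring2.
- rewrite [in U _]e UX e /= U4 /to_Modd /= comp_Xn_poly /F; ring2.
- rewrite [in U _]e UX e /= U6 /to_Modd /= !raddfD /= !comp_Xn_poly comp_polyX.
  rewrite FE; ring2.
have -> : to_Modd (C k.+2.+4) = to_Modd (C k.+1.+4) + F ^+ 2 * to_Modd (C k)
    + (F + G) ^+ 2 * to_Modd 'X^k.
  have -> : C k.+2.+4 = C k.+1.+4
    + ('X^6 + 'X^5 + 'X^2 + 'X) * C k + s * 'X^k by rewrite [s * _]mulrC.
  move: (C _) (C k) 'X^k => p q r; rewrite addFG FE !to_ModdD !to_ModdM.
  by rewrite !raddfD /= !comp_Xn_poly comp_polyX; ring2.
have -> : to_Modd 'X^(k.+2.+4) = to_Modd 'X^(k.+1.+4) + G ^+ 2 * to_Modd 'X^k.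
  by rewrite -to_Modd_XMl -raddfD; congr to_Modd; rewrite !exprS; ring2.
rewrite -!IH; [|lia..].
move: (to_Modd _) (to_Modd _) => p q.
by rewrite linearD /= expr2 -mulrA !U_G; ring2.
Qed.

Lemma U_to_Modd g : U (to_Modd g) + to_Modd g = to_Modd (phi g).
Proof.
have -> : to_Modd g = \sum_(i < size g) g`_i *: to_Modd 'X^i.
  rewrite -{1}[g]coefK poly_def raddf_sum.
  by apply: eq_bigr => i _ /=; rewrite linearZ.
rewrite /phi !raddf_sum -big_split /=.
by apply: eq_bigr => i _; rewrite !linearZ /= -scalerDr U_to_Modd_Xn.
Qed.

Lemma K_ker_phi f : K U f <-> exists2 g, ker_phi g & f = to_Modd g.
Proof.
split=> [[[g _ <-]] /eqP|[g kg ->]].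
  rewrite U_to_Modd (raddf_eq0 _ to_Modd_inj) => /eqP kg.
  by exists g.
by split; [exists g | rewrite U_to_Modd kg raddf0].
Qed.

Lemma K_basis (P : pred nat) g :
  is_basis P g ker_phi -> is_basis P (to_Modd \o g) (K U).
Proof.
move=> [gK gfree gspan].
have sumE N c : \sum_(n < N | P n) c n *: (to_Modd \o g) n
    = to_Modd (\sum_(n < N | P n) c n *: g n).
  by rewrite raddf_sum; apply: eq_bigr => i _ /=; rewrite linearZ.
split=> [n Pn|N c|x /K_ker_phi[p /gspan[N [c pE]] ->]].
- by apply/K_ker_phi; exists (g n) => //; exact: gK.
- rewrite sumE => /eqP; rewrite (raddf_eq0 _ to_Modd_inj) => /eqP.
  exact: gfree.
by exists N, c; rewrite sumE pE.
Qed.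

(** * K is contained in N2 *)

Local Notation L := (UW U).

Lemma L_mulG f : L (G * f) = F * L f.
Proof. by rewrite /UW U_G rmorphM /= WG mulrDr. Qed.

Lemma L1 : L 1 = 0.
Proof. by have [_ [[U0 _ _] _]] := Uis; rewrite /UW U0 rmorph1 addpp. Qed.

Lemma L_Xn i : (0 < i < 6)%N -> L 'X^i = 1.
Proof.
have [_ [[U0 U1 U2] [U3 U4 U5]]] := Uis.
case: i => [|[|[|[|[|[|//]]]]]] // _.
all: rewrite /UW ?expr1 ?U1 ?U2 ?U3 ?U4 ?U5 ?rmorphXn /= !WX; ring2.
Qed.

(** Divide repeatedly by [G]: the remainders, of degree at most 5, are mapped to
    constants, and each factor [G] comes out as [F]. *)
Lemma L_comp_F f : exists q, L f = q \Po F.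
Proof.
have [n] := ubnP (size f); elim: n f => // n IH f ltn.
have [c cE] : exists c, L (f %% G) = c%:P.
  have sr : (size (f %% G)%R <= 6)%N.
    by rewrite -ltnS -size_GE ltn_modp G_neq0.
  exists (\sum_(i < size (f %% G)) (f %% G)`_i * (0 < i)%N%:R).
  rewrite -{1}[f %% G]coefK poly_def !raddf_sum.
  apply: eq_bigr => i _ /=; rewrite linearZ /=.
  case: (posnP i) => [->|i0]; first by rewrite L1 scaler0 mulr0.
  rewrite L_Xn ?mulr1 ?alg_polyC //.
  by rewrite i0 (leq_trans (ltn_ord i)).
have [f0|f0] := eqVneq (f %/ G) 0.
  by exists c%:P; rewrite {1}(divp_eq f G) f0 mul0r add0r cE comp_polyC.
have [|q qE] := IH (f %/ G).
  rewrite size_divp ?G_neq0 // size_GE.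
  have : (0 < size f)%N.
    by rewrite size_poly_gt0; apply: contraNneq f0 => ->; rewrite div0p.
  move: ltn; rewrite /= !ltnS; case: (size f) => //= k; lia.
exists ('X * q + c%:P).
rewrite {1}(divp_eq f G) raddfD /= mulrC L_mulG qE cE.
by rewrite comp_polyD comp_polyM comp_polyX comp_polyC.
Qed.

(** At [r = 0] the polynomials [F] and [G] vanish to the orders 1 and 5. So if
    [q] vanishes to the order [v] at 0, then [q(F)] and [q(G)] vanish to the
    orders [v] and [5 v]; these agree only for [v = 0]. *)
Lemma comp_FG_eq0 (q : {poly 'F_2}) : q \Po F = q \Po G -> root q 0 -> q = 0.
Proof.
move=> qFG q0; apply/eqP; apply/negPn/negP => qn0.
have [v [p pn0 qE]] := multiplicity_XsubC q 0.
rewrite qn0 /= subr0 in pn0 qE.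
have v0 : (0 < v)%N.
  by case: v qE q0 => // ->; rewrite expr0 mulr1 (negPf pn0).
have FsE : F = s * ('X + 1) ^+ 4 by rewrite /F; ring2.
have GsE : G = s * 'X ^+ 4 by rewrite /G; ring2.
move: qFG; rewrite qE !comp_polyM !rmorphXn /= !comp_polyX {2}FsE {2}GsE.
rewrite ![(s * _) ^+ v]exprMn !(mulrCA _ (s ^+ v)).
move/(mulfI (expf_neq0 v s_neq0))/(congr1 (horner^~ 0)).
have F0 : F.[0] = 0 by rewrite /F hornerM hornerX mul0r.
have G0 : G.[0] = 0 by rewrite /G hornerM hornerXn expr0n mul0r.
rewrite !hornerM !horner_exp !horner_comp F0 G0 hornerD hornerX hornerC add0r.
have z0 : (0 : 'F_2) ^+ 4 ^+ v = 0.
  by rewrite -exprM expr0n muln_eq0 orFb eqn0Ngt v0.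
rewrite !expr1n mulr1 z0 mulr0 => /eqP p0.
by rewrite /root p0 in pn0.
Qed.

(** For [f] fixed by [U], [L f = f + W f] is invariant under [W] and of the form
    [q(F)]; this forces [q(F) = q(G)]. *)
Lemma L_K_eq0 f : K U f -> L f = 0.
Proof.
move=> [[g _ <-] Uff].
set f0 := to_Modd g in Uff *.
have UE : U f0 = f0 by apply/eqP; rewrite -subr_eq0 subrF2 Uff.
have [q qE] := L_comp_F f0.
have LE : L f0 = f0 + W f0 by rewrite /UW UE.
suff q0 : q = 0 by rewrite qE q0 comp_poly0.
apply: comp_FG_eq0.
  (* W fixes f0 + W f0 = q(F) and turns F into G. *)
  rewrite -qE -[G]WF -[RHS]/(comp_poly _ _).
  have -> : q \Po W F = W (q \Po F) by rewrite /W comp_polyA.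
  by rewrite -qE LE raddfD /= WK addrC.
(* The constant term of q is f0(0) + f0(1), and s vanishes at 0 and 1. *)
have := congr1 (horner^~ 0) qE; rewrite LE hornerD /W !horner_comp.
rewrite /f0 /to_Modd /F !hornerE expr0n /= => /esym.
rewrite ?mul0r ?add0r /root => ->.
by rewrite (_ : 1 ^+ 2 + 0 + 1 = 0) ?mul0r //; apply/val_inj.
Qed.

Lemma gen_add l x y : gen l x -> gen l y -> gen l (x + y).
Proof.
move=> [a ->] [b ->]; exists (fun i => a i + b i).
by rewrite -big_split; apply: eq_bigr => i _; rewrite comp_polyD mulrDl.
Qed.

Lemma gen_mul l a x : gen l x -> gen l ((a \Po G ^+ 2) * x).
Proof.
move=> [b ->]; exists (fun i => a * b i).
by rewrite mulr_sumr; apply: eq_bigr => i _; rewrite comp_polyM mulrA.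
Qed.

Lemma gen_nth l i : (i < size l)%N -> gen l l`_i.
Proof.
move=> lti; exists (fun j => (j == i)%:R).
rewrite (bigD1 (Ordinal lti)) //= eqxx comp_polyC mul1r big1 ?addr0 // => j.
by rewrite -val_eqE /= => /negPf ->; rewrite comp_poly0 mul0r.
Qed.

Lemma gen0 l : gen l 0.
Proof.
by exists (fun=> 0); rewrite big1 // => i _; rewrite comp_poly0 mul0r.
Qed.

Lemma gen_scale l (c : 'F_2) x : gen l x -> gen l (c *: x).
Proof. by move/(gen_mul c%:P); rewrite comp_polyC mul_polyC. Qed.

Lemma gen_sum l (I : Type) (r : seq I) (P : pred I) (x : I -> {poly 'F_2}) :
  (forall i, P i -> gen l (x i)) -> gen l (\sum_(i <- r | P i) x i).
Proof. by move=> h; apply: big_ind => //; [exact: gen0|exact: gen_add]. Qed.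

(** The generator of M(odd), of degree 8, that completes the generators of
    [N2]. *)
Definition u3 := to_Modd 'X^3.
Definition Modd_gens := [:: u0; u1; u2; u4; u5; u3].

Lemma u0E : u0 = to_Modd 1.
Proof. by rewrite /u0 addFG /to_Modd rmorph1 mulr1. Qed.

Lemma u1E : u1 = to_Modd 'X.
Proof. rewrite /u1 addFG /to_Modd comp_polyX /G; ring2. Qed.

Lemma u2E : u2 = to_Modd 'X^2.
Proof. rewrite /u2 /to_Modd comp_Xn_poly /G; ring2. Qed.

Lemma u4E : u4 + u3 = to_Modd 'X^4.
Proof. rewrite /u4 /u3 /to_Modd addFG !comp_Xn_poly /G; ring2. Qed.

Lemma u5_factor : u5 = G * (G * 1 + ('X^5 + 'X^2)).
Proof.
have s4 : s ^+ 4 = 'X^8 + 'X^4 by ring2.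
by rewrite /u5 addFG s4 -[F in LHS](addrK G) subrF2 addFG /G; ring2.
Qed.

Lemma u5E : u5 + u3 = to_Modd 'X^5.
Proof. rewrite u5_factor /u3 /to_Modd !comp_Xn_poly /G; ring2. Qed.

(** Divide by [t^6 + t^5], which corresponds to [G^2]; what remains is to
    express [to_Modd 'X^i] for [i < 6]. *)
Lemma Modd_gen g : gen Modd_gens (to_Modd g).
Proof.
have base i : (i < 6)%N -> gen Modd_gens (to_Modd 'X^i).
  have h j : (j < 6)%N -> gen Modd_gens Modd_gens`_j.
    exact: (@gen_nth Modd_gens).
  case: i => [|[|[|[|[|[|//]]]]]] _.
  - by rewrite expr0 -u0E; exact: (h 0%N).
  - by rewrite expr1 -u1E; exact: (h 1%N).
  - by rewrite -u2E; exact: (h 2%N).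
  - exact: (h 5%N).
  - by rewrite -u4E; apply: gen_add; [exact: (h 3%N)|exact: (h 5%N)].
  - by rewrite -u5E; apply: gen_add; [exact: (h 4%N)|exact: (h 5%N)].
have [n] := ubnP (size g); elim: n g => // n IH g ltn.
pose H : {poly 'F_2} := 'X^6 + 'X^5.
have sH : size H = 7%N by rewrite size_polyDl ?size_polyXn.
have H0 : H != 0 by rewrite -size_poly_eq0 sH.
rewrite (divp_eq g H) to_ModdD; apply: gen_add.
  have [->|g0] := eqVneq (g %/ H) 0; first by rewrite mul0r raddf0; exact: gen0.
  rewrite mulrC to_Modd_XMl -(comp_polyX (G ^+ 2)).
  apply: gen_mul; apply: IH.
  rewrite size_divp // sH.
  have : (0 < size g)%N.
    by rewrite size_poly_gt0; apply: contraNneq g0 => ->; rewrite div0p.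
  move: ltn; rewrite /= !ltnS; case: (size g) => //= k; lia.
rewrite -[g %% H]coefK poly_def raddf_sum; apply: gen_sum => i _ /=.
rewrite linearZ; apply/gen_scale/base/(leq_trans (ltn_ord i)).
by rewrite -ltnS -sH ltn_modp.
Qed.

Lemma L_compG2 a f : L ((a \Po G ^+ 2) * f) = (a \Po F ^+ 2) * L f.
Proof.
elim/poly_ind: a => [|a c IH]; first by rewrite !comp_poly0 !mul0r raddf0.
rewrite !comp_polyD !comp_polyM !comp_polyX !comp_polyC !mulrDl raddfD /=.
rewrite !mul_polyC linearZ /=; congr (_ + _).
by rewrite mulrAC mulrC expr2 -mulrA !L_mulG IH; ring.
Qed.

Lemma L_u0 : L u0 = 0.
Proof.
have L1' : L 'X = 1 by rewrite -['X]expr1 L_Xn.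
by rewrite /u0 addFG raddfD /= L1' L_Xn // addpp.
Qed.

Lemma L_u1 : L u1 = 0.
Proof.
have -> : u1 = 'X^4 + 'X^3 by rewrite u1E /to_Modd comp_polyX; ring2.
by rewrite raddfD /= !L_Xn // addpp.
Qed.

Lemma L_u2 : L u2 = 0.
Proof. by rewrite /u2 -[G]mulr1 L_mulG L1 mulr0. Qed.

Lemma L_u4 : L u4 = 0.
Proof.
have -> : u4 = G * ('X^4 + 'X^2) by rewrite /u4 addFG; ring2.
by rewrite L_mulG raddfD /= !L_Xn // addpp mulr0.
Qed.

Lemma L_u5 : L u5 = 0.
Proof.
rewrite u5_factor L_mulG !raddfD /= L_mulG L1 !L_Xn //.
by rewrite addpp mulr0 addr0 mulr0.
Qed.

Lemma L_e3 : L u3 = F.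
Proof.
have -> : u3 = G * 'X^2 by rewrite /u3 /to_Modd comp_Xn_poly /G; ring2.
by rewrite L_mulG L_Xn // mulr1.
Qed.

Lemma F_neq0 : F != 0.
Proof.
by rewrite /F mulf_neq0 ?expf_neq0 ?polyX_eq0 // -(rmorph1 polyC) -size_poly_eq0
  size_XaddC.
Qed.

Lemma size_F : size F = 7%N.
Proof.
rewrite -WG /W size_comp_poly2 ?size_GE //.
by rewrite -(rmorph1 polyC) size_XaddC.
Qed.

(** Write [f = n + a(G^2) u3] with [n] in [N2]. Then [0 = L f = a(F^2) F], so
    [a = 0]. *)
Lemma K_sub_N2 : K U `<=` N2.
Proof.
move=> f Kf; have Lf0 := L_K_eq0 Kf; have [[g _ gf] _] := Kf.
move: Lf0; rewrite -gf; have [a ->] := Modd_gen g.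
rewrite !big_ord_recr big_ord0 /= add0r !raddfD /= !L_compG2.
rewrite L_u0 L_u1 L_u2 L_u4 L_u5 L_e3 !mulr0 !add0r => /eqP.
rewrite mulf_eq0 (negPf F_neq0) orbF comp_poly_eq0; last first.
  by have := size_exp F 2; rewrite size_F /=; case: (size _) => // -[].
move=> /eqP ->; rewrite comp_poly0 mul0r addr0.
exists a; by rewrite !big_ord_recr big_ord0 /= add0r.
Qed.

End Operator.

(** * The J_k are independent modulo N1 *)

Definition lowest (k : nat) (p : {poly 'F_2}) :=
  exists2 q, p = 'X^k * q & q.[0] != 0.

Lemma lowestM j k p q : lowest j p -> lowest k q -> lowest (j + k) (p * q).
Proof.
move=> [p' -> p0] [q' -> q0]; exists (p' * q'); first by rewrite exprD mulrACA.
by rewrite hornerM mulf_neq0.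
Qed.

Lemma lowestX k n p : lowest k p -> lowest (n * k) (p ^+ n).
Proof.
move=> [q -> q0]; exists (q ^+ n); first by rewrite exprMn mulnC exprM.
by rewrite horner_exp expf_neq0.
Qed.

(** The coefficient of [r^k] in the sum, with [k] minimal in [l], comes from
    [w k] alone. *)
Lemma lowest_free (w : nat -> {poly 'F_2}) (l : seq nat) :
  uniq l -> {in l, forall k, lowest k (w k)} -> \sum_(k <- l) w k = 0 ->
  l = [::].
Proof.
move=> ul wl; case: l ul wl => // k1 l; set l' := k1 :: l => ul wl sum0.
have ex : exists k, k \in l' by exists k1; exact: mem_head.
have [k kl kmin] := ex_minnP ex.
have := congr1 (fun p : {poly 'F_2} => p`_k) sum0.
rewrite (bigD1_seq k) //= coefD coef_sum big_seq_cond big1 ?addr0 => [|j].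
  have [q -> q0] := wl _ kl.
  rewrite coefXnM ltnn subnn coef0 -horner_coef0 => /eqP.
  by rewrite (negPf q0).
case/andP=> jl jk; have [q -> _] := wl _ jl.
by rewrite coefXnM ltn_neqAle eq_sym jk kmin.
Qed.

Lemma J_add10 k : J (k + 10) = G ^+ 2 * J k.
Proof. by rewrite addnC. Qed.

Lemma J_add10M k i : J (k + 10 * i) = (G ^+ 2) ^+ i * J k.
Proof.
elim: i => [|i IH]; first by rewrite muln0 addn0 expr0 mul1r.
rewrite mulnS (addnC 10%N) addnA J_add10 IH; by rewrite mulrA -exprS.
Qed.

(** After multiplication by [G], this is [F^8 = F G (F + G)^2 + G^8], that is,
    [s^8 = s^6 s^2]. *)
Lemma J3E : J 3 = F ^+ 3 + F * G ^+ 2 + G ^+ 7.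
Proof.
apply: (mulIf G_neq0); rewrite F8_divG -[F](addrK G) subrF2 addFG.
have -> : (s + G) ^+ 8 = s ^+ 6 * s ^+ 2 + G ^+ 8.
  move: s G => x y.
  have sq (a b : {poly 'F_2}) : (a + b) ^+ 2 = a ^+ 2 + b ^+ 2 by ring2.
  by rewrite -[8%N]/(2 * 2 * 2)%N !exprM !sq -!exprM -exprD.
rewrite -mulFG -addFG; ring2.
Qed.

Lemma Jidx_mod10 k : Jidx k = (k %% 10 \in [:: 1; 3; 7; 9])%N.
Proof.
rewrite /Jidx -coprime_modl.
case: k => [|k] //; rewrite ltn0Sn /=.
have := ltn_pmod k.+1 (isT : (0 < 10)%N).
by case: (_ %% _)%N => [|[|[|[|[|[|[|[|[|[|]]]]]]]]]].
Qed.

Lemma horner_X1n n : (('X + 1 : {poly 'F_2}) ^+ n).[0] = 1.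
Proof. by rewrite horner_exp hornerD hornerX hornerC add0r expr1n. Qed.

Lemma lowest_G : lowest 5 G.
Proof. by exists ('X + 1); rewrite // -['X + 1]expr1 horner_X1n oner_eq0. Qed.

Lemma lowest_F : lowest 1 F.
Proof. by exists (('X + 1) ^+ 5); rewrite // horner_X1n oner_eq0. Qed.

Lemma lowest_J k : Jidx k -> lowest k (J k).
Proof.
rewrite Jidx_mod10 => kmod.
have {1 2}-> : k = (2 * (k %/ 10) * 5 + k %% 10)%N.
  by rewrite mulnAC mulnC -divn_eq.
have -> : J (2 * (k %/ 10) * 5 + k %% 10) = G ^+ (2 * (k %/ 10)) * J (k %% 10).
  by rewrite addnC mulnAC J_add10M exprM.
apply: lowestM; first exact/lowestX/lowest_G.
move: kmod; rewrite !inE => /or4P[] /eqP ->.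
- exact: lowest_F.
- exists (('X + 1) ^+ 39); last by rewrite horner_X1n oner_eq0.
  apply: (mulIf G_neq0); rewrite F8_divG /F /G; move: ('X + 1) => y.
  by rewrite exprMn -exprM [RHS]mulrACA -exprD -exprSr.
- exact: (lowestM (lowestX 2 lowest_F) lowest_G).
exact: (lowestM (lowestX 4 lowest_F) lowest_G).
Qed.

Lemma modN1D : {morph modN1 : x y / x + y}.
Proof. exact: raddfD. Qed.

Lemma modN1_eq0 f : modN1 f = 0 <-> gen [:: G] f.
Proof.
have z0 : modN1 0 = 0 by exact: raddf0.
have e : (modN1 f == modN1 0) = (f \in N1_zmod).
  by rewrite -[f in RHS]subr0 Quotient.idealrBE.
rewrite -z0; split=> [/eqP|Gf]; first by rewrite e => /asboolP.
by apply/eqP; rewrite e; apply/asboolP.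
Qed.

Lemma modN1_sum (I : Type) (r : seq I) (P : pred I) (x : I -> {poly 'F_2}) :
  modN1 (\sum_(i <- r | P i) x i) = \sum_(i <- r | P i) modN1 (x i).
Proof. exact: raddf_sum. Qed.

Lemma addqq (x : quotN1) : x + x = 0.
Proof.
have [f ->] : exists f, x = modN1 f by exists (repr x); rewrite /modN1 reprK.
by rewrite -modN1D addpp; exact: raddf0.
Qed.

Lemma oppq (x : quotN1) : - x = x.
Proof. by apply/eqP; rewrite eq_sym -addr_eq0 addqq. Qed.

(** A relation modulo [N1] is a relation between the [J_k] and the odd powers
    [G^(2i+1)], whose lowest degrees [k] and [10 i + 5] are all distinct. *)
Lemma J_free (l : seq nat) : uniq l -> all Jidx l ->
  \sum_(k <- l) modN1 (J k) = 0 -> l = [::].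
Proof.
move=> ul /allP Jl; rewrite -modN1_sum => /modN1_eq0[a].
rewrite big_ord1 /= comp_polyE mulr_suml => sumE.
(* T lists the lowest degrees of the terms of the element of N1. *)
pose T := [seq (10 * i + 5)%N | i <- iota 0 (size (a 0%N)) & (a 0%N)`_i != 0].
pose w k := if (k %% 10 == 5)%N then G ^+ (k %/ 5) else J k.
have wT i : w (10 * i + 5)%N = (G ^+ 2) ^+ i * G.
  have -> : (10 * i + 5 = (2 * i).+1 * 5)%N by lia.
  rewrite /w mulnK // -exprM exprSr ifT //; apply/eqP; lia.
have wl k : k \in l -> w k = J k.
  by move/Jl; rewrite Jidx_mod10 /w; case: eqP => // ->.
suff : l ++ T = [::] by case: (l).
apply: (@lowest_free w).
- rewrite cat_uniq ul /= map_inj_uniq; [|by move=> i j; lia].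
  rewrite filter_uniq ?iota_uniq //.
  rewrite andbT; apply/hasPn => k /mapP[i _ ->]; apply/negP => /Jl.
  rewrite Jidx_mod10 (_ : (_ %% _)%N = 5) //; lia.
- move=> k; rewrite mem_cat => /orP[kl|/mapP[i _ ->]].
    by rewrite wl //; apply/lowest_J/Jl.
  rewrite wT -exprM -exprSr (_ : (10 * i + 5 = (2 * i).+1 * 5)%N); last lia.
  exact/lowestX/lowest_G.
rewrite big_cat /= (eq_big_seq _ wl) sumE /T big_map big_filter.
rewrite -(big_mkord xpredT (fun i => (a 0%N)`_i *: (G ^+ 2) ^+ i * G)) /=.
rewrite /index_iota subn0 [X in _ + X]big_mkcond -big_split /=.
apply: big1 => i _; case: eqP => [->|/eqP/F2_neq0 ->] /=.
  by rewrite scale0r mul0r addr0.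
by rewrite scale1r wT addpp.
Qed.

(** * The decomposition of N2/N1 *)

Lemma spanJ0 P : spanJ P 0.
Proof. by exists [::]; rewrite big_nil. Qed.

Lemma spanJD P x y : spanJ P x -> spanJ P y -> spanJ P (x + y).
Proof.
move=> [l [lP ->]] [l' [lP' ->]]; exists (l ++ l').
by rewrite all_cat lP lP' big_cat.
Qed.

Lemma spanJ_J (P : pred nat) k : Jidx k -> P k -> spanJ P (modN1 (J k)).
Proof. by move=> Jk Pk; exists [:: k]; rewrite /= Jk Pk big_seq1. Qed.

Lemma spanJ_sum (P : pred nat) (l : seq nat) : all Jidx l -> all P l ->
  spanJ P (\sum_(k <- l) modN1 (J k)).
Proof. by move=> Jl Pl; exists l; rewrite all_predI Jl Pl. Qed.

Lemma spanJ_sub (P Q : pred nat) x : (forall k, Jidx k -> P k -> Q k) ->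
  spanJ P x -> spanJ Q x.
Proof.
move=> PQ [l [/allP lP ->]]; exists l; split=> //.
by apply/allP => k /lP/andP[Jk Pk]; rewrite Jk PQ.
Qed.

(** A repeated index can be dropped twice, as [x + x = 0]. *)
Lemma spanJ_uniq (P : pred nat) x : spanJ P x ->
  exists l, [/\ uniq l, all (fun k => Jidx k && P k) l
                & x = \sum_(k <- l) modN1 (J k)].
Proof.
case=> l [lP ->] {x}; elim: l lP => [_|k l IH /= /andP[kP /IH[l' [ul lP lE]]]].
  by exists [::].
rewrite big_cons lE; have [kl|kl] := boolP (k \in l').
  exists (rem k l'); rewrite rem_uniq //; split=> //.
    by apply/allP => j /mem_rem/(allP lP).
  by rewrite (big_rem k kl) /= addrA addqq add0r.
by exists (k :: l'); rewrite /= kl ul kP lP big_cons.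
Qed.

Lemma spanJ_disj (P Q : pred nat) x : (forall k, Jidx k -> P k -> ~~ Q k) ->
  spanJ P x -> spanJ Q x -> x = 0.
Proof.
move=> PQ /spanJ_uniq[l [ul lP xE]] /spanJ_uniq[l' [ul' lQ xE']].
suff : l ++ l' = [::] by rewrite xE; case: (l) => //; rewrite big_nil.
have sub (R : pred nat) m : all (fun k => Jidx k && R k) m -> all Jidx m.
  by apply: sub_all => k /andP[].
apply: J_free; last by rewrite big_cat /= -xE -xE' addqq.
- rewrite cat_uniq ul ul' andbT /=; apply/hasPn => k /(allP lQ)/andP[_ Qk].
  by apply/negP => /(allP lP)/andP[Jk] /(PQ _ Jk); rewrite Qk.
by rewrite all_cat (sub _ _ lP) (sub _ _ lQ).
Qed.

Lemma spanJ_split (P A : pred nat) x : spanJ P x ->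
  exists y z, [/\ x = y + z, spanJ (predI A P) y & spanJ (predC A) z].
Proof.
case=> l [lP ->] {x}.
exists (\sum_(k <- l | A k) modN1 (J k)), (\sum_(k <- l | ~~ A k) modN1 (J k)).
split; first by rewrite (bigID A).
  rewrite -big_filter; exists (filter A l); split=> //.
  by apply/allP => k; rewrite mem_filter /= => /andP[-> /(allP lP)].
rewrite -big_filter; exists (filter (predC A) l); split=> //.
by apply/allP => k; rewrite mem_filter /= => /andP[-> /(allP lP)/andP[->]].
Qed.

Definition aidx (k : nat) := (k %% 20 \in [:: 1; 3; 7; 9])%N.

Lemma N2bE x : spanJ (predC aidx) x -> N2b x.
Proof.
apply: spanJ_sub => k; rewrite Jidx_mod10 /aidx /= !inE; lia.
Qed.

Lemma proj_N2aE y z : N2a y -> N2b z -> proj_N2a (y + z) = y.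
Proof.
move=> ya zb; apply: xget_subset1; first by rewrite /= [y + z]addrC addrK.
move=> u v [ua ub] [va vb]; apply/eqP; rewrite -subr_eq0; apply/eqP.
apply: (@spanJ_disj aidx (fun k => (k %% 20 \in [:: 11; 13; 17; 19])%N)).
- by move=> k _; rewrite /aidx !inE; lia.
- by rewrite oppq; exact: (spanJD ua va).
have -> : u - v = (y + z - u) + (y + z - v).
  by rewrite !oppq addrACA addqq add0r.
exact: (spanJD ub vb).
Qed.

Lemma to_N2aP f : spanJ xpredT (modN1 f) ->
  N2a (to_N2a f) /\ N2b (modN1 f - to_N2a f).
Proof.
move=> /(spanJ_split aidx)[y [z [fE yA zB]]].
have ya : N2a y by apply: spanJ_sub yA => k _ /andP[].
rewrite /to_N2a fE proj_N2aE //; last exact: N2bE.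
by split=> //; rewrite [y + z]addrC addrK; exact: N2bE.
Qed.

Lemma to_N2aD f h : spanJ xpredT (modN1 f) -> spanJ xpredT (modN1 h) ->
  to_N2a (f + h) = to_N2a f + to_N2a h.
Proof.
move=> /to_N2aP[fa fb] /to_N2aP[ha hb].
rewrite {1}/to_N2a modN1D -[modN1 f](subrK (to_N2a f)).
rewrite -[modN1 h](subrK (to_N2a h)) addrACA addrC proj_N2aE //.
  exact: (spanJD fa ha).
exact: (spanJD fb hb).
Qed.

(** * The filtration of N2 by degree *)

(** The leading term of the summand of largest degree cannot be cancelled. *)
Lemma size_sum_distinct (n : nat) (p : 'I_n -> {poly 'F_2}) :
  (forall i j, p i != 0 -> size (p i) = size (p j) -> i = j) ->
  forall i, (size (p i) <= size (\sum_j p j)%R)%N.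
Proof.
move=> inj i.
pose sz j : nat := size (p j).
case: (@arg_maxnP _ i xpredT sz isT) => // m _ max.
apply: leq_trans (max i isT) _.
have lem j : (size (p j) <= size (p m))%N by exact: max.
rewrite /sz.
have [->|pm] := eqVneq (p m) 0; first by rewrite size_poly0.
rewrite leqNgt; apply/negP => lt.
have : (\sum_j p j)`_(size (p m)).-1 = 0.
  by rewrite nth_default // -ltnS prednK // size_poly_gt0.
rewrite (bigD1 m) //= coefD coef_sum big1 => [|j jm].
  by rewrite addr0 -/(lead_coef _) => /eqP; rewrite lead_coef_eq0 (negPf pm).
rewrite nth_default // -ltnS prednK ?size_poly_gt0 // ltn_neqAle lem andbT.
by apply: contraNneq jm => /esym/inj ->.
Qed.

Definition N2gens := [:: u0; u1; u2; u4; u5].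

(** The degrees of the [u_j] in [r]. *)
Definition N2deg (j : nat) : nat := nth 0 [:: 2; 4; 6; 10; 12] j.

Lemma size_N2gens j : (j < 5)%N -> size (N2gens`_j) = (N2deg j).+1.
Proof.
have s2 (m n : nat) : (n < m)%N -> size ('X^m + 'X^n : {poly 'F_2}) = m.+1.
  by move=> nm; rewrite size_polyDl ?size_polyXn.
have u4X : u4 = to_Modd ('X^4 + 'X^3).
  by rewrite to_ModdD -u4E -addrA addpp addr0.
have u5X : u5 = to_Modd ('X^5 + 'X^3).
  by rewrite to_ModdD -u5E -addrA addpp addr0.
case: j => [|[|[|[|[|//]]]]] _ /=.
- by rewrite u0E size_to_Modd ?oner_eq0 // size_poly1.
- by rewrite u1E size_to_Modd ?polyX_eq0 // size_polyX.
- by rewrite u2E size_to_Modd -?size_poly_eq0 size_polyXn.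
- by rewrite u4X size_to_Modd -?size_poly_eq0 s2.
by rewrite u5X size_to_Modd -?size_poly_eq0 s2.
Qed.

Lemma size_compG2_mul (a u : {poly 'F_2}) : a != 0 -> u != 0 ->
  size ((a \Po G ^+ 2) * u) = (12 * (size a).-1 + size u)%N.
Proof.
move=> a0 u0.
have sG2 : size (G ^+ 2) = 13%N by rewrite size_Gn.
have aG : a \Po G ^+ 2 != 0 by rewrite comp_poly_eq0 ?sG2.
rewrite size_mul //; have := size_comp_poly a (G ^+ 2); rewrite sG2.
move: aG; rewrite -size_poly_gt0; case: (size (a \Po _)) => // k _.
by rewrite addSn /= => ->; rewrite mulnC.
Qed.

(** The degrees 2, 4, 6, 10, 12 are distinct modulo 12, the degree of [G^2], so
    no cancellation of leading terms occurs in a Z/2[G^2]-combination of the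
    [u_j]. *)
Lemma N2_filtered_ind (S : {poly 'F_2} -> Prop) (d : nat) h :
  S 0 -> (forall x y, S x -> S y -> S (x + y)) ->
  (forall j i, (j < 5)%N -> (N2deg j + 12 * i < d)%N ->
    S ((G ^+ 2) ^+ i * N2gens`_j)) ->
  N2 h -> (size h <= d)%N -> S h.
Proof.
move=> S0 SD Sgen [a ->] sd.
pose p (j : 'I_5) := (a j \Po G ^+ 2) * N2gens`_j.
have nz (j : 'I_5) : N2gens`_j != 0.
  by rewrite -size_poly_eq0 size_N2gens ?ltn_ord.
have sz (j : 'I_5) : a j != 0 ->
    size (p j) = (12 * (size (a j)).-1 + (N2deg j).+1)%N.
  by move=> a0; rewrite /p (size_compG2_mul a0 (nz j)) size_N2gens.
have le (j : 'I_5) : (size (p j) <= d)%N.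
  apply: leq_trans sd; apply: (size_sum_distinct (p := p)) => {}j k p0 eqs.
  have aj : a j != 0.
    by apply: contraNneq p0 => aj; rewrite /p aj comp_poly0 mul0r.
  have ak : a k != 0.
    apply: contraNneq p0 => ak; rewrite -size_poly_eq0 eqs /p ak.
    by rewrite comp_poly0 mul0r size_poly0.
  move: eqs; rewrite !sz // => eqs.
  have: (N2deg j == N2deg k %[mod 12])%N by lia.
  move: (ltn_ord j) (ltn_ord k) => j5 k5 degs; apply: val_inj; move: j5 k5 degs.
  rewrite /=; move: (nat_of_ord j) (nat_of_ord k).
  by move=> [|[|[|[|[|?]]]]] [|[|[|[|[|?]]]]].
apply: big_ind => // j _; rewrite comp_polyE mulr_suml.
apply: big_ind => // i _.
case: (eqVneq (a j)`_i 0) => [->|/F2_neq0 ->]; first by rewrite scale0r mul0r.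
rewrite scale1r; apply: Sgen => //.
have aj : a j != 0 by rewrite -size_poly_gt0 (leq_trans _ (ltn_ord i)).
have := le j; rewrite sz //; have := ltn_ord i.
move: (nat_of_ord i) => k; case: (size (a j)) => [|n] //=; lia.
Qed.

(** The indices of the [J_k] whose sum is the [j]-th generator of [N2] modulo
    [N1]. *)
Definition JN2 (j : nat) : seq nat :=
  nth [::] [:: [:: 1]; [:: 3; 7]; [::]; [:: 7]; [:: 7; 9; 11]]%N j.

Lemma N2gens_J j : (j < 5)%N ->
  gen [:: G] (N2gens`_j - \sum_(k <- JN2 j) J k).
Proof.
have [J1 J7 J9 J11] : [/\ J 1 = F, J 7 = F ^+ 2 * G, J 9 = F ^+ 4 * G
  & J 11 = G ^+ 2 * F] by [].
case: j => [|[|[|[|[|//]]]]] _; rewrite subrF2;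
  [exists (fun=> 1)|exists (fun=> 'X^3 + 'X + 1)|exists (fun=> 1)
  |exists (fun=> 'X)|exists (fun=> 'X^2)];
  rewrite big_ord1 ?comp_polyD ?comp_Xn_poly ?comp_polyX ?rmorph1 /JN2 /=
    ?big_cons big_nil ?(J1, J3E, J7, J9, J11) /u0 /u1 /u2 /u4 /u5; ring2.
Qed.

Lemma modN1_N2gens j i : (j < 5)%N ->
  modN1 ((G ^+ 2) ^+ i * N2gens`_j) = \sum_(k <- JN2 j) modN1 (J (k + 10 * i)).
Proof.
move=> j5; apply/eqP; rewrite -modN1_sum -subr_eq0 -raddfB; apply/eqP/modN1_eq0.
rewrite (eq_bigr _ (fun k _ => J_add10M k i)) -mulr_sumr -mulrBr -comp_Xn_poly.
exact/gen_mul/N2gens_J.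
Qed.

Lemma JN2_Jidx j i : (j < 5)%N -> all Jidx [seq (k + 10 * i)%N | k <- JN2 j].
Proof.
rewrite all_map => j5; have: all Jidx (JN2 j) by case: j j5 => [|[|[|[|[|]]]]].
apply: sub_all => k /=; rewrite !Jidx_mod10 => kJ.
by rewrite (_ : (k + 10 * i) %% 10 = k %% 10)%N //; lia.
Qed.

Lemma N2_spanJ (P : pred nat) (d : nat) h : N2 h -> (size h <= d)%N ->
  (forall j i, (j < 5)%N -> (N2deg j + 12 * i < d)%N ->
     all P [seq (k + 10 * i)%N | k <- JN2 j]) ->
  spanJ P (modN1 h).
Proof.
move=> N2h hd Pgen.
apply: (N2_filtered_ind (S := fun h => spanJ P (modN1 h))) N2h hd.
- have -> : modN1 0 = 0 by exact: raddf0.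
  exact: spanJ0.
- by move=> x y xP yP; rewrite modN1D; exact: spanJD.
move=> j i j5 ij; rewrite modN1_N2gens //.
rewrite -(big_map (fun k => k + 10 * i)%N xpredT (fun k => modN1 (J k))).
exact: spanJ_sum (JN2_Jidx _ _) (Pgen _ _ _ _).
Qed.

Lemma N2_spanJT h : N2 h -> spanJ xpredT (modN1 h).
Proof.
by move=> N2h; apply: (N2_spanJ N2h (leqnn _)) => *; rewrite all_predT.
Qed.

(** * The images of the f_n *)

Definition aidx_le (b : int) (k : nat) := aidx k && (k%:Z <= b)%R.

(** The predicate [P] bounds only the indices that count for [N2a]: the others
    are lost in the projection. The error [f - M] is controlled by its degree,
    and [M] is known modulo [N1]. *)
Lemma to_N2a_approx (f M : {poly 'F_2}) (d k : nat) (l : seq nat) (b : int) :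
  let P := fun i => aidx i ==> (i%:Z <= b)%R in
  N2 f -> N2 M -> (size (f - M)%R <= d)%N ->
  (forall j i, (j < 5)%N -> (N2deg j + 12 * i < d)%N ->
     all P [seq (k + 10 * i)%N | k <- JN2 j]) ->
  Jidx k -> aidx k -> all Jidx l -> all P l ->
  gen [:: G] (M - (J k + \sum_(i <- l) J i)) ->
  exists2 z, spanJ (aidx_le b) z & to_N2a f = modN1 (J k) + z.
Proof.
move=> P N2f N2M fMd Pgen Jk Ak Jl Pl /modN1_eq0 ME.
have N2fM : N2 (f - M) by rewrite subrF2; exact: gen_add.
have fE : modN1 f = modN1 (J k) + (modN1 (f - M) + \sum_(i <- l) modN1 (J i)).
  have -> : modN1 f = modN1 (f - M) + modN1 M by rewrite -modN1D subrK.
  have -> : modN1 M = modN1 (J k + \sum_(i <- l) J i).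
    by apply/eqP; rewrite -subr_eq0 -raddfB; apply/eqP.
  by rewrite [modN1 (J k + _)]modN1D modN1_sum addrCA.
have := spanJD (N2_spanJ N2fM fMd Pgen) (spanJ_sum Jl Pl).
rewrite -/P => /(spanJ_split aidx)[y [z [yzE yP zA]]].
have yA : spanJ (aidx_le b) y.
  apply: spanJ_sub yP => i _ /andP[/= iA /implyP/(_ iA) ib].
  by rewrite /aidx_le iA.
exists y => //; rewrite /to_N2a fE yzE addrA proj_N2aE //; last exact: N2bE.
apply: spanJD; first exact: spanJ_J.
by apply: spanJ_sub yA => i _ /andP[].
Qed.

Lemma size_Odeg (c : int) (p : {poly 'F_2}) (d : nat) :
  Odeg c p -> (2 * c + 3 <= d%:Z)%R -> (size (to_Modd p) <= d)%N.
Proof.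
have [->|p0] := eqVneq p 0; first by rewrite raddf0 size_poly0.
rewrite size_to_Modd // /Odeg => /(_ p0).
by move: p0; rewrite -size_poly_gt0; case: (size p) => //= n; lia.
Qed.

Lemma to_Modd_XnMl n q :
  to_Modd (('X^6 + 'X^5) ^+ n * q) = (G ^+ 2) ^+ n * to_Modd q.
Proof.
elim: n => [|n IH]; first by rewrite !expr0 !mul1r.
by rewrite [_ ^+ n.+1]exprS -mulrA to_Modd_XMl IH mulrA -exprS.
Qed.

(** The previous lemma for [f = to_Modd g] and [M = G^(4m) to_Modd q], where
    [to_Modd q] is [J_k] plus the [J_i], [i] in [l], modulo [N1]. Multiplication
    by [G^(4m)] shifts the indices by [20 m]. *)
Lemma to_Modd_approx (g q : {poly 'F_2}) (m k : nat) (l : seq nat)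
    (c b : int) (d : nat) :
  let P := fun i => aidx i ==> (i%:Z <= b)%R in
  N2 (to_Modd g) -> Odeg c (g - ('X^6 + 'X^5) ^+ (2 * m) * q) ->
  (2 * c + 3 <= d%:Z)%R ->
  (forall j i, (j < 5)%N -> (N2deg j + 12 * i < d)%N ->
     all P [seq (k + 10 * i)%N | k <- JN2 j]) ->
  N2 (to_Modd q) -> Jidx k -> aidx k -> all Jidx l ->
  all P [seq (20 * m + i)%N | i <- l] ->
  gen [:: G] (to_Modd q - (J k + \sum_(i <- l) J i)) ->
  exists2 z, spanJ (aidx_le b) z
    & to_N2a (to_Modd g) = modN1 (J (20 * m + k)) + z.
Proof.
move=> P N2g gq cd Pgen N2q Jk Ak Jl Pl qE.
have Jm i : J (20 * m + i) = (G ^+ 2) ^+ (2 * m) * J i.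
  by rewrite -J_add10M addnC mulnA.
have Jidxm i : Jidx (20 * m + i) = Jidx i.
  by rewrite !Jidx_mod10 (_ : (20 * m + i) %% 10 = i %% 10)%N //; lia.
apply: (@to_N2a_approx _ ((G ^+ 2) ^+ (2 * m) * to_Modd q) d _
  [seq (20 * m + i)%N | i <- l]) => //.
- by rewrite -comp_Xn_poly; exact: gen_mul.
- by rewrite -to_Modd_XnMl -raddfB; exact: size_Odeg gq cd.
- by rewrite Jidxm.
- by move: Ak; rewrite /aidx (_ : (20 * m + k) %% 20 = k %% 20)%N //; lia.
- by rewrite all_map; apply: sub_all Jl => i /=; rewrite Jidxm.
rewrite big_map Jm (eq_bigr _ (fun i _ => Jm i)) -mulr_sumr -mulrDr -mulrBr.
by rewrite -comp_Xn_poly; exact: gen_mul.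
Qed.

Lemma N2gens_N2 j : (j < 5)%N -> N2 (N2gens`_j).
Proof. exact: (@gen_nth N2gens). Qed.

Lemma to_N2a_12m m g : N2 (to_Modd g) ->
  Odeg (12 * m%:Z - 2) (g - ('X^6 + 'X^5) ^+ (2 * m)) ->
  exists2 z, spanJ (aidx_le (20 * m%:Z - 11)) z
    & to_N2a (to_Modd g) = modN1 (J (20 * m + 1)) + z.
Proof.
move=> N2g; rewrite -[_ ^+ (2 * m)]mulr1 => gq.
apply: (@to_Modd_approx g 1 m 1 [::] _ _ (24 * m - 1) N2g gq) => //.
- lia.
- by case=> [|[|[|[|[|]]]]] // i _; rewrite /N2deg /aidx /= !inE; lia.
- by rewrite -u0E; exact: (@N2gens_N2 0).
have := N2gens_J (isT : (0 < 5)%N).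
by rewrite big_seq1 -u0E big_nil addr0.
Qed.

Lemma to_N2a_12m6 m g : N2 (to_Modd g) ->
  Odeg (12 * m%:Z) (g - ('X^6 + 'X^5) ^+ (2 * m)
    * ('X^6 + 'X^5 + 'X^4 + 'X^3 + 'X^2 + 'X)) ->
  exists2 z, spanJ (aidx_le (20 * m%:Z + 1)) z
    & to_N2a (to_Modd g) = modN1 (J (20 * m + 3)) + z.
Proof.
move=> N2g gq.
have qE : to_Modd ('X^6 + 'X^5 + 'X^4 + 'X^3 + 'X^2 + 'X) =
    ('X \Po G ^+ 2) * u0 + u4 + u2 + u1.
  have -> : 'X^6 + 'X^5 + 'X^4 + 'X^3 + 'X^2 + 'X
    = ('X^6 + 'X^5) * 1 + ('X^4 + 'X^3) + 'X^2 + 'X :> {poly 'F_2} by ring2.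
  rewrite !to_ModdD to_Modd_XMl -u0E -u1E -u2E -u4E -/u3 -[u4 + u3 + u3]addrA.
  by rewrite addpp addr0 comp_polyX.
apply: (@to_Modd_approx g _ m 3 [:: 11] _ _ (24 * m + 3) N2g gq) => //.
- lia.
- by case=> [|[|[|[|[|]]]]] // i _; rewrite /N2deg /aidx /= !inE; lia.
- rewrite qE; apply: gen_add; [apply: gen_add; [apply: gen_add|]|].
  + exact/gen_mul/(@N2gens_N2 0).
  + exact: (@N2gens_N2 3).
  + exact: (@N2gens_N2 2).
  exact: (@N2gens_N2 1).
- by rewrite /aidx /= !inE; lia.
rewrite qE; exists (fun=> 'X^3 + 'X).
rewrite subrF2 big_seq1 big_ord1 J3E (_ : J 11 = G ^+ 2 * F) //.
by rewrite comp_polyD comp_Xn_poly comp_polyX /u0 /u1 /u2 /u4 /=; ring2.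
Qed.

Lemma to_N2a_12m2 m g : N2 (to_Modd g) ->
  Odeg (12 * m%:Z) (g - ('X^6 + 'X^5) ^+ (2 * m) * ('X^2 + 'X)) ->
  exists2 z, spanJ (aidx_le (20 * m%:Z + 3)) z
    & to_N2a (to_Modd g) = modN1 (J (20 * m + 7)) + z.
Proof.
move=> N2g gq.
have qE : to_Modd ('X^2 + 'X) = u2 + u1 by rewrite to_ModdD -u1E -u2E.
apply: (@to_Modd_approx g _ m 7 [:: 3] _ _ (24 * m + 3) N2g gq) => //.
- lia.
- by case=> [|[|[|[|[|]]]]] // i _; rewrite /N2deg /aidx /= !inE; lia.
- by rewrite qE; apply: gen_add; [exact: (@N2gens_N2 2)|exact: (@N2gens_N2 1)].
- by rewrite /aidx /= !inE; lia.
rewrite qE; exists (fun=> 'X^3 + 'X).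
rewrite subrF2 big_seq1 big_ord1 J3E (_ : J 7 = F ^+ 2 * G) //.
by rewrite comp_polyD comp_Xn_poly comp_polyX /u1 /u2 /=; ring2.
Qed.

Lemma OdegE (c : nat) p : Odeg c p <-> (size p <= c.+1)%N.
Proof.
rewrite /Odeg -size_poly_gt0; case: (size p) => [|n] //=.
by split=> [/(_ isT)|le _]; rewrite ?lez_nat.
Qed.

(** Here [to_Modd 'X^8] is not in [N2]; it differs by [to_Modd 'X^3], of degree
    8, from an element of [N2]. As [H^(2m) t^3] has degree [12 m + 3], where
    [H = t^6 + t^5], adding it to the main term does not change the bound on the
    error. *)
Lemma to_N2a_12m8 m g : N2 (to_Modd g) ->
  Odeg (12 * m%:Z + 4) (g - ('X^6 + 'X^5) ^+ (2 * m) * 'X^8) ->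
  exists2 z, spanJ (aidx_le (20 * m%:Z + 7)) z
    & to_N2a (to_Modd g) = modN1 (J (20 * m + 9)) + z.
Proof.
move=> N2g gq.
have qE : to_Modd ('X^8 + 'X^3) = ('X \Po G ^+ 2) * (u2 + u1 + u0) + u5.
  have -> : 'X^8 + 'X^3 = ('X^6 + 'X^5) * ('X^2 + 'X + 1) + ('X^5 + 'X^3)
    :> {poly 'F_2} by ring2.
  rewrite to_ModdD to_Modd_XMl !to_ModdD -u0E -u1E -u2E -u5E -/u3.
  by rewrite -[u5 + u3 + u3]addrA addpp addr0 comp_polyX.
have {}gq : Odeg (12 * m%:Z + 4) (g - ('X^6 + 'X^5) ^+ (2 * m) * ('X^8 + 'X^3)).
  move: gq; rewrite (_ : 12 * m%:Z + 4 = (12 * m + 4)%N) ?PoszD ?PoszM //.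
  rewrite !OdegE mulrDr opprD addrA => gq.
  apply: leq_trans (size_polyD _ _) _; rewrite geq_max gq size_polyN.
  have sH : size ('X^6 + 'X^5 : {poly 'F_2}) = 7%N.
    by rewrite size_polyDl ?size_polyXn.
  have H0 : ('X^6 + 'X^5 : {poly 'F_2}) != 0 by rewrite -size_poly_eq0 sH.
  rewrite size_mul ?expf_neq0 ?polyX_eq0 // size_polyXn.
  have := size_exp ('X^6 + 'X^5 : {poly 'F_2}) (2 * m).
  by rewrite sH /=; move: (size _) => k; lia.
apply: (@to_Modd_approx g _ m 9 [:: 7; 13; 17] _ _ (24 * m + 11) N2g gq) => //.
- lia.
- by case=> [|[|[|[|[|]]]]] // i _; rewrite /N2deg /aidx /= !inE; lia.
- rewrite qE; apply: gen_add; last exact: (@N2gens_N2 4).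
  apply/gen_mul/gen_add; last exact: (@N2gens_N2 0).
  by apply: gen_add; [exact: (@N2gens_N2 2)|exact: (@N2gens_N2 1)].
- by rewrite /aidx /= !inE; lia.
rewrite qE; exists (fun=> 'X^4 + 'X).
rewrite subrF2 !big_cons big_nil big_ord1 (_ : J 7 = F ^+ 2 * G) //.
rewrite (_ : J 9 = F ^+ 4 * G) // (_ : J 13 = G ^+ 2 * J 3) // J3E.
rewrite (_ : J 17 = G ^+ 2 * (F ^+ 2 * G)) //.
by rewrite comp_polyD comp_Xn_poly comp_polyX /u0 /u1 /u2 /u5 /=; ring2.
Qed.

(** * Triangularity gives bijectivity *)

Section Bijection.
Variables (U : {linear {poly 'F_2} -> {poly 'F_2}}).
Variables (f : nat -> {poly 'F_2}) (kap : nat -> nat).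
Hypotheses (f_basis : is_basis gidx f (K U)) (KN2 : K U `<=` N2).
Hypothesis f_lead : forall n, gidx n -> exists2 z,
  spanJ (fun k => aidx k && (k < kap n)%N) z
  & to_N2a (f n) = modN1 (J (kap n)) + z.
Hypothesis kapP : forall n, gidx n -> Jidx (kap n) /\ aidx (kap n).
Hypothesis kap_inj : {in gidx &, injective kap}.
Hypothesis kap_surj : forall k, Jidx k -> aidx k ->
  exists2 n, gidx n & kap n = k.

Lemma K0 : K U 0.
Proof. by split; [exists 0; rewrite ?raddf0 | rewrite raddf0 addr0]. Qed.

Lemma KD x y : K U x -> K U y -> K U (x + y).
Proof.
move=> [[g _ gx] xU] [[h _ hy] yU]; split.
  by exists (g + h); rewrite // to_ModdD gx hy.
by rewrite raddfD addrACA /= xU yU addr0.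
Qed.

Lemma to_N2a_KD x y : K U x -> K U y -> to_N2a (x + y) = to_N2a x + to_N2a y.
Proof. by move=> /KN2 xN /KN2 yN; apply: to_N2aD; exact: N2_spanJT. Qed.

Lemma to_N2a0 : to_N2a 0 = 0.
Proof. by have := to_N2a_KD K0 K0; rewrite addr0 addqq. Qed.

(** In a nonzero combination of the [f n], the one with the largest [kap n]
    contributes a [J_(kap n)] that nothing cancels. *)
Lemma to_N2a_K_eq0 x : K U x -> to_N2a x = 0 -> x = 0.
Proof.
have [fK _ fspan] := f_basis; move=> /[dup] Kx /fspan[N [c xE]] Tx0.
pose p (n : 'I_N) := gidx n && (c n != 0).
have [n0 pn0|pN] := pickP p; last first.
  rewrite xE big1 // => n gn.
  by have := pN n; rewrite /p gn /= => /negbFE/eqP ->; rewrite scale0r.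
have {n0 pn0}[n /andP[gn cn] nmax] := arg_maxnP (fun n : 'I_N => kap n) pn0.
pose S y := K U y /\ spanJ (fun k => aidx k && (k < kap n)%N) (to_N2a y).
have rest : S (\sum_(i < N | gidx i && (i != n)) c i *: f i).
  apply: (big_ind S) => [|y y' [Ky Ty] [Ky' Ty']|i /andP[gi ni]].
  - by split; [exact: K0|rewrite to_N2a0; exact: spanJ0].
  - by split; [exact: KD|rewrite to_N2a_KD //; exact: spanJD].
  have [->|ci] := eqVneq (c i) 0.
    by rewrite scale0r; split; [exact: K0|rewrite to_N2a0; exact: spanJ0].
  rewrite (F2_neq0 ci) scale1r; split; first exact: fK.
  have [z zi ->] := f_lead gi; have [Ji Ai] := kapP gi.
  have lt_in : (kap i < kap n)%N.
    rewrite ltn_neqAle; apply/andP; split; last first.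
      by apply: nmax; rewrite /p gi ci.
    by apply: contraNneq ni => /(kap_inj gi gn)/val_inj ->.
  apply: spanJD; first by apply: spanJ_J; rewrite ?Ai.
  by apply: spanJ_sub zi => k _ /andP[-> /ltn_trans]; exact.
have [z zn Tn] := f_lead gn; have [Jn An] := kapP gn.
have [Kr Tr] := rest.
move: Tx0; rewrite xE (bigD1 n) //= (F2_neq0 cn) scale1r.
rewrite to_N2a_KD //; last exact: fK.
rewrite Tn -addrA => /eqP; rewrite addr_eq0 oppq => /eqP JE.
have J0 : modN1 (J (kap n)) = 0.
  apply: (@spanJ_disj (pred1 (kap n)) (fun k => aidx k && (k < kap n)%N)).
  - by move=> k _ /eqP ->; rewrite ltnn andbF.
  - by apply: spanJ_J => //=.
  by rewrite JE; exact: spanJD.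
by have := @J_free [:: kap n]; rewrite /= Jn big_seq1 => /(_ isT isT J0).
Qed.

(** By induction on [k]: the [f n] with [kap n = k] is mapped to [J_k] up to
    smaller indices. *)
Lemma J_in_image k : Jidx k -> aidx k ->
  exists2 x, K U x & to_N2a x = modN1 (J k).
Proof.
have [fK _ _] := f_basis.
elim/ltn_ind: k => k IH Jk Ak.
have [n gn kn] := kap_surj Jk Ak.
have [z [l [/allP lP zE]] Tn] := f_lead gn; rewrite kn in lP Tn.
suff [x Kx Tx] : exists2 x, K U x & to_N2a x = z.
  exists (f n + x); first by apply: KD => //; exact: fK.
  by rewrite to_N2a_KD ?Tn ?Tx -?addrA ?addqq ?addr0 //; exact: fK.
rewrite {}zE big_seq.
apply: (big_ind (fun z => exists2 x, K U x & to_N2a x = z)).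
- by exists 0; [exact: K0|exact: to_N2a0].
- move=> _ _ [x Kx <-] [y Ky <-].
  by exists (x + y); [exact: KD|exact: to_N2a_KD].
by move=> j /lP/andP[Jj /andP[Aj jk]]; exact: IH.
Qed.

Lemma to_N2a_bij : set_bij (K U) N2a to_N2a.
Proof.
split=> [x /KN2 /N2_spanJT/to_N2aP[] //|x y|z [l [/allP lP ->]]].
  move=> /set_mem Kx /set_mem Ky Txy.
  apply/eqP; rewrite -subr_eq0 subrF2; apply/eqP.
  by apply: to_N2a_K_eq0; [exact: KD|rewrite to_N2a_KD // Txy addqq].
rewrite big_seq.
apply: (big_ind (fun z => (to_N2a @` K U) z)).
- by exists 0; [exact: K0|exact: to_N2a0].
- move=> _ _ [x Kx <-] [y Ky <-].
  by exists (x + y); [exact: KD|exact: to_N2a_KD].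
by move=> j /lP/andP[Jj Aj]; have [x Kx <-] := J_in_image Jj Aj; exists x.
Qed.

End Bijection.

(** The index of the leading term of the image of [f_n]: [12 m + r] goes to
    [20 m + 1, 20 m + 7, 20 m + 3, 20 m + 9] for [r = 0, 2, 6, 8]. The entries 0
    stand for the residues that do not occur. *)
Definition leadJ (n : nat) : nat :=
  20 * (n %/ 12) + nth 0%N [:: 1; 0; 7; 0; 0; 0; 3; 0; 9] (n %% 12).

Lemma gidxP n : gidx n -> exists m,
  [\/ n = (12 * m)%N, n = (12 * m + 6)%N, n = (12 * m + 2)%N
    | n = (12 * m + 8)%N].
Proof.
move=> gn; exists (n %/ 12)%N.
have : ((n == 12 * (n %/ 12)) || (n == 12 * (n %/ 12) + 6)
    || (n == 12 * (n %/ 12) + 2) || (n == 12 * (n %/ 12) + 8))%N.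
  move: gn; rewrite /gidx; lia.
move=> /orP[/orP[/orP[]|]|] /eqP e.
- by constructor 1.
- by constructor 2.
- by constructor 3.
by constructor 4.
Qed.

Lemma leadJE m :
  [/\ leadJ (12 * m) = (20 * m + 1)%N, leadJ (12 * m + 6) = (20 * m + 3)%N,
      leadJ (12 * m + 2) = (20 * m + 7)%N
    & leadJ (12 * m + 8) = (20 * m + 9)%N].
Proof.
have e r : (r < 12)%N -> leadJ (12 * m + r) =
    (20 * m + nth 0%N [:: 1; 0; 7; 0; 0; 0; 3; 0; 9]%N r)%N.
  move=> r12; rewrite /leadJ (mulnC 12%N).
  by rewrite divnMDl // modnMDl divn_small // modn_small // addn0.
by rewrite -{1}[(12 * m)%N]addn0 !e.
Qed.

Lemma leadJP n : gidx n -> Jidx (leadJ n) /\ aidx (leadJ n).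
Proof.
move=> /gidxP[m]; have [e0 e6 e2 e8] := leadJE m.
by rewrite Jidx_mod10 /aidx; case=> ->; rewrite ?(e0, e6, e2, e8) !inE; lia.
Qed.

Lemma leadJ_inj : {in gidx &, injective leadJ}.
Proof.
move=> n n' /gidxP[m nE] /gidxP[m' nE'].
have [e0 e6 e2 e8] := leadJE m; have [e0' e6' e2' e8'] := leadJE m'.
case: nE => ->; case: nE' => ->;
  by rewrite ?(e0, e6, e2, e8) ?(e0', e6', e2', e8'); lia.
Qed.

Lemma leadJ_surj k : Jidx k -> aidx k -> exists2 n, gidx n & leadJ n = k.
Proof.
move=> _; have [e0 e6 e2 e8] := leadJE (k %/ 20).
have kE := divn_eq k 20; rewrite /aidx !inE => /or4P[] /eqP r.
- by exists (12 * (k %/ 20))%N; rewrite ?e0 /gidx; lia.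
- by exists (12 * (k %/ 20) + 6)%N; rewrite ?e6 /gidx; lia.
- by exists (12 * (k %/ 20) + 2)%N; rewrite ?e2 /gidx; lia.
by exists (12 * (k %/ 20) + 8)%N; rewrite ?e8 /gidx; lia.
Qed.

Theorem theorem4p10 (U : {linear {poly 'F_2} -> {poly 'F_2}})
    (g : nat -> {poly 'F_2}) :
  is_U U ->
  is_basis gidx g ker_phi ->
  (forall n, gidx n -> size (g n) = n.+1) ->
  (forall m : nat,
    [/\ Odeg (12 * m%:Z - 2)
          (g (12 * m)%N - ('X^6 + 'X^5) ^+ (2 * m)),
        Odeg (12 * m%:Z)
          (g (12 * m + 6)%N - ('X^6 + 'X^5) ^+ (2 * m)
             * ('X^6 + 'X^5 + 'X^4 + 'X^3 + 'X^2 + 'X)),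
        Odeg (12 * m%:Z)
          (g (12 * m + 2)%N - ('X^6 + 'X^5) ^+ (2 * m) * ('X^2 + 'X))
      & Odeg (12 * m%:Z + 4)
          (g (12 * m + 8)%N - ('X^6 + 'X^5) ^+ (2 * m) * 'X^8)]) ->
  let f := fun n : nat => ('X^2 + 'X) * (g n \Po 'X^2) in
  [/\ is_basis gidx f (K U),
      K U `<=` N2,
      forall m : nat,
      [/\ exists2 z, Ostar (20 * m%:Z - 11) z
            & to_N2a (f (12 * m)%N) = modN1 (J (20 * m + 1)) + z,
          exists2 z, Ostar (20 * m%:Z + 1) z
            & to_N2a (f (12 * m + 6)%N) = modN1 (J (20 * m + 3)) + z,
          exists2 z, Ostar (20 * m%:Z + 3) z
            & to_N2a (f (12 * m + 2)%N) = modN1 (J (20 * m + 7)) + z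
        & exists2 z, Ostar (20 * m%:Z + 7) z
            & to_N2a (f (12 * m + 8)%N) = modN1 (J (20 * m + 9)) + z]
    & set_bij (K U) N2a to_N2a].
Proof.
move=> Uis g_basis _ g_lead f.
have KN2 := K_sub_N2 Uis.
have f_basis : is_basis gidx f (K U) := K_basis Uis g_basis.
have fN2 n : gidx n -> N2 (to_Modd (g n)).
  by case: f_basis => fK _ _ /fK/KN2.
have g0 m : gidx (12 * m) by rewrite /gidx; lia.
have g6 m : gidx (12 * m + 6) by rewrite /gidx; lia.
have g2 m : gidx (12 * m + 2) by rewrite /gidx; lia.
have g8 m : gidx (12 * m + 8) by rewrite /gidx; lia.
have la m := to_N2a_12m (fN2 _ (g0 m)) (let: And4 h _ _ _ := g_lead m in h).
have lb m := to_N2a_12m6 (fN2 _ (g6 m)) (let: And4 _ h _ _ := g_lead m in h).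
have lc m := to_N2a_12m2 (fN2 _ (g2 m)) (let: And4 _ _ h _ := g_lead m in h).
have ld m := to_N2a_12m8 (fN2 _ (g8 m)) (let: And4 _ _ _ h := g_lead m in h).
have belowE b z : spanJ (aidx_le b) z -> Ostar b z.
  by apply: spanJ_sub => k _ /andP[].
have below_lt b (d : nat) z : (b < d%:Z)%R -> spanJ (aidx_le b) z ->
    spanJ (fun k => aidx k && (k < d)%N) z.
  by move=> bd; apply: spanJ_sub => k _ /andP[-> /= kb]; lia.
split=> //.
  move=> m; split.
  - by have [z /belowE] := la m; exists z.
  - by have [z /belowE] := lb m; exists z.
  - by have [z /belowE] := lc m; exists z.
  by have [z /belowE] := ld m; exists z.
apply: (to_N2a_bij f_basis KN2 _ leadJP leadJ_inj leadJ_surj) => n /gidxP[m].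
have [e0 e6 e2 e8] := leadJE m.
case=> ->; rewrite ?(e0, e6, e2, e8).
- by have [z zb] := la m; exists z => //; apply: below_lt zb; lia.
- by have [z zb] := lb m; exists z => //; apply: below_lt zb; lia.
- by have [z zb] := lc m; exists z => //; apply: below_lt zb; lia.
by have [z zb] := ld m; exists z => //; apply: below_lt zb; lia.
Qed.
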